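(* For metric (simultaneous) transportation games with $n$ players and $m$ buses, $\mathrm{PoA}(U)=\Theta\left(\frac{n}{m}\right)$.
   Context: Transportation game. An instance $\Gamma$ consists of a set of players $N=\{1,\dots,n\}$, a set of buses $M=\{1,\dots,m\}$ with $m\ge 2$, a complete undirected graph on the vertex set $V=N\cup\{s,t\}$ ($s$ the source, $t$ the destination) with a distance function $d$ assigning a nonnegative real $d(x,y)=d(y,x)$ to each edge (with $d(x,x)=0$), and for each bus $j\in M$ a permutation $\pi_j$ of $N$. The instance is metric if $d(x,w)\le d(x,y)+d(y,w)$ for all $x,y,w\in V$. Distances between distinct vertices may be $0$. An outcome is a map $\sigma:N\to M$, $\sigma_i$ being the bus chosen by player $i$; $\mathcal{P}$ is the set of outcomes. Given $\sigma$, bus $j$ starts at $s$, visits exactly the players $i$ with $\sigma_i=j$, in the order in which they appear in $\pi_j$, and ends at $t$. Let $n_j=|\{i:\sigma_i=j\}|$, let $p^j_i$ be the $i$-th player visited by bus $j$, and put $p^j_{n_j+1}=t$. The cost of the player $p^j_k$ is $c_{p^j_k}(\sigma)=\sum_{l=k}^{n_j} d(p^j_l,p^j_{l+1})$, the distance travelled by her bus from her location to $t$. The utilitarian social cost function is $U(\sigma)=\sum_{i\in N}c_i(\sigma)$. An outcome $\sigma$ is a (pure) Nash equilibrium if for every $i\in N$ and every outcome $\sigma'$ with $\sigma'_i\ne\sigma_i$ and $\sigma'_k=\sigma_k$ for all $k\ne i$, $c_i(\sigma)\le c_i(\sigma')$. Let $\mathrm{NE}(\Gamma)$ be the set of Nash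 equilibria. Only games with $\mathrm{NE}(\Gamma)\neq\emptyset$ are considered. For a social cost function $f:\mathcal{P}\to\mathbb{R}$, with $\sigma^*\in\mathcal{P}$ an outcome minimizing $f$, $\mathrm{PoA}(f,\Gamma)=\max_{\sigma\in \mathrm{NE}(\Gamma)} f(\sigma)/f(\sigma^* )$ (for games where this ratio is defined, i.e. $f(\sigma^* )>0$), and for a class $\mathcal{G}$ of games $\mathrm{PoA}(f,\mathcal{G})=\sup_{\Gamma\in\mathcal{G}}\mathrm{PoA}(f,\Gamma)$. $\mathrm{PoA}(U)$ denotes $\mathrm{PoA}(U,\mathcal{G})$ where $\mathcal{G}$ is the class of metric transportation games with $n$ players and $m$ buses.
   Formalization: The upper bound PoA(U) = O(n/m) is stated only for n ≥ m, since PoA(U) ≥ 1 for all n ≥ 1 makes it false as n/m tends to 0 (e.g. n = 1, m large); the lower bound is stated for all n ≥ 1, m ≥ 2. *)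

(* Defs.v *)
From HB Require Import structures.
From mathcomp Require Import all_boot all_order all_algebra perm.
From mathcomp Require Import all_classical all_reals ereal.

Set Implicit Arguments.
Unset Strict Implicit.
Unset Printing Implicit Defensive.

Import Order.TTheory GRing.Theory Num.Theory.
Local Open Scope classical_set_scope.
Local Open Scope ring_scope.

Inductive vertex (n : nat) : Type :=
| Player of 'I_n
| Source
| Dest.

Arguments Source {n}.
Arguments Dest {n}.

(* [order j k] is the player in position [k] of the permutation of bus [j]. *)
Record game (R : realType) (n m : nat) := Game {
  dist : vertex n -> vertex n -> R;
  order : 'I_m -> {perm 'I_n};
  dist_ge0 : forall x y, 0 <= dist x y;
  dist_sym : forall x y, dist x y = dist y x;
  dist_xx : forall x, dist x x = 0
}.

Definition metric (R : realType) (n m : nat) (G : game R n m) : Prop :=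
  forall x y w, dist G x w <= dist G x y + dist G y w.

Definition outcome (n m : nat) := {ffun 'I_n -> 'I_m}.

Definition route (R : realType) (n m : nat) (G : game R n m)
    (sigma : outcome n m) (j : 'I_m) : seq 'I_n :=
  [seq i <- [seq order G j k | k <- enum 'I_n] | sigma i == j].

(* Stops are numbered from 0; the default value of [nth] puts [Dest] right
   after the last player. *)
Definition stop (R : realType) (n m : nat) (G : game R n m)
    (sigma : outcome n m) (j : 'I_m) (l : nat) : vertex n :=
  nth Dest [seq Player i | i <- route G sigma j] l.

Definition cost (R : realType) (n m : nat) (G : game R n m)
    (sigma : outcome n m) (i : 'I_n) : R :=
  let j := sigma i in
  \sum_(index i (route G sigma j) <= l < size (route G sigma j))
    dist G (stop G sigma j l) (stop G sigma j l.+1).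

Definition utilitarian (R : realType) (n m : nat) (G : game R n m)
    (sigma : outcome n m) : R :=
  \sum_(i < n) cost G sigma i.

Definition nash (R : realType) (n m : nat) (G : game R n m)
    (sigma : outcome n m) : Prop :=
  forall (i : 'I_n) (sigma' : outcome n m),
    sigma' i != sigma i -> (forall k, k != i -> sigma' k = sigma k) ->
    cost G sigma i <= cost G sigma' i.

Definition minimizer (R : realType) (n m : nat) (f : outcome n m -> R)
    (opt : outcome n m) : Prop :=
  forall sigma, f opt <= f sigma.

(* There are finitely many outcomes, so the supremum is a maximum as soon as
   the game has a Nash equilibrium. *)
Definition PoA_game (R : realType) (n m : nat) (f : outcome n m -> R)
    (G : game R n m) : \bar R :=
  ereal_sup [set r | exists sigma opt : outcome n m,
    [/\ nash G sigma, minimizer f opt & r = (f sigma / f opt)%:E]].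

(* Only the games having a Nash equilibrium and a positive optimum count. *)
Definition PoA (R : realType) (n m : nat)
    (f : game R n m -> outcome n m -> R) (C : set (game R n m)) : \bar R :=
  ereal_sup [set PoA_game (f G) G | G in
    [set G | [/\ C G, exists sigma, nash G sigma
               & exists2 opt, minimizer (f G) opt & 0 < f G opt]]].

Definition PoA_U (R : realType) (n m : nat) : \bar R :=
  PoA (@utilitarian R n m) [set G | metric G].

(* Main.v *)
(* Write x_i = d(i, t).  In a metric game U(sigma) >= X := \sum_i x_i for every
   outcome, and a detour through t shows that a player i riding bus j pays at
   most x_i + 2 * (the sum of x_k over the other passengers k of bus j).  At an
   equilibrium player i could move to any bus, so averaging this bound over the
   m buses gives c_i <= x_i + 2 X / m, hence U(sigma) <= (1 + 2 n / m) X.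
   For the lower bound put min(n, m) "far" players at distance 1 from t, the
   others at t itself, and let every bus visit the far players last.  Spreading
   the far players over the buses is an equilibrium in which every other player
   pays 2, whereas gathering them in one bus costs only min(n, m) in total. *)
Require Import Defs.
From mathcomp Require Import all_boot all_order all_algebra perm.
From mathcomp Require Import all_classical all_reals ereal.
From mathcomp Require Import zify ring lra.
Import Order.TTheory GRing.Theory Num.Theory.
Local Open Scope ring_scope.

Set Implicit Arguments.
Unset Strict Implicit.

(** * Costs as lengths of remaining routes *)

Fixpoint travel (R : realType) (n m : nat) (G : game R n m) (x : vertex n)
    (s : seq 'I_n) : R :=
  if s is y :: s' then dist G x (Player y) + travel G (Player y) s'
  else dist G x Dest.

Lemma travelE (R : realType) n m (G : game R n m) (i : 'I_n) (r s : seq 'I_n) :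
  let stops := [seq Player k | k <- r ++ i :: s] in
  \sum_(size r <= l < size (r ++ i :: s))
    dist G (nth Dest stops l) (nth Dest stops l.+1) = travel G (Player i) s.
Proof.
rewrite /=; elim: r => [|k r IHr] /=; last by rewrite big_add1.
elim: s i => [|k s IHs] i; first by rewrite big_nat1.
by rewrite big_nat_recl //= -[in RHS]IHs.
Qed.

Lemma mem_route (R : realType) n m (G : game R n m) (sigma : outcome n m) j i :
  (i \in route G sigma j) = (sigma i == j).
Proof.
rewrite mem_filter andb_idr // => _.
by apply/mapP; exists ((Defs.order G j)^-1 i)%g; rewrite ?mem_enum ?permKV.
Qed.

Lemma uniq_route (R : realType) n m (G : game R n m) (sigma : outcome n m) j :
  uniq (route G sigma j).
Proof. by rewrite filter_uniq// map_inj_uniq ?enum_uniq//; apply: perm_inj. Qed.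

(** Trades the indexed sum in [cost] for a recursion on the passengers [s] visited after [i], so
    that bounds on costs go by induction on [s]. *)
Lemma cost_travel (R : realType) n m (G : game R n m) (sigma : outcome n m) i :
  exists r s, route G sigma (sigma i) = r ++ i :: s /\
              cost G sigma i = travel G (Player i) s.
Proof.
have ir : i \in route G sigma (sigma i) by rewrite mem_route.
have ur := uniq_route G sigma (sigma i).
rewrite /cost /stop; case/splitPr: ir ur => r s ur; exists r, s; split=> //.
suff -> : index i (r ++ i :: s) = size r by apply: travelE.
rewrite index_cat /= eqxx addn0.
by move: ur; rewrite cat_uniq /= negb_or => /and3P[_ /andP[/negPf->]].
Qed.

(** * Upper bound from the triangle inequality *)

Section Metric.
Context (R : realType) (n m : nat) (G : game R n m).
Hypothesis metricG : metric G.
Implicit Types (sigma : outcome n m) (i : 'I_n).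

Let to_dest i := dist G (Player i) Dest.

Lemma travel_ge x s : dist G x Dest <= travel G x s.
Proof.
elim: s x => //= y s IHs x.
by apply: le_trans (metricG _ (Player y) _) _; rewrite lerD2l.
Qed.

Lemma travel_ge_via x s i : i \in s ->
  dist G x (Player i) + dist G (Player i) Dest <= travel G x s.
Proof.
elim: s x => //= y s IHs x; rewrite inE => /orP[/eqP->|/IHs le_s].
  by rewrite lerD2l travel_ge.
apply: le_trans (lerD (lexx _) (le_s (Player y))).
by rewrite addrA lerD2r.
Qed.

(** Once every leg is sent through [Dest], each passenger of [s] is reached from [Dest] and left
    towards [Dest], hence the factor 2. *)
Lemma travel_le x s :
  travel G x s <= dist G x Dest + 2 * \sum_(i <- s) to_dest i.
Proof.
elim: s x => [|y s IHs] x /=; first by rewrite big_nil mulr0 addr0.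
rewrite big_cons; have := IHs (Player y).
have := metricG x Dest (Player y); rewrite (dist_sym G Dest) -/(to_dest y).
lra.
Qed.

Lemma cost_ge sigma i : to_dest i <= cost G sigma i.
Proof. by have [r [s [_ ->]]] := cost_travel G sigma i; apply: travel_ge. Qed.

Lemma cost_le sigma i :
  cost G sigma i <=
  to_dest i + 2 * \sum_(k | (k != i) && (sigma k == sigma i)) to_dest k.
Proof.
have [r [s [rE ->]]] := cost_travel G sigma i.
apply: le_trans (travel_le _ _) _; rewrite lerD2l ler_pM2l//.
have := uniq_route G sigma (sigma i).
rewrite rE cat_uniq /= => /and4P[_ _ i_s us].
rewrite big_uniq//= [leLHS]big_mkcond [leRHS]big_mkcond /=.
apply: ler_sum => k _; case: ifPn => ks; last by case: ifP; rewrite ?dist_ge0.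
have -> : k != i by apply: contraNneq i_s => <-.
by rewrite -(mem_route G) rE mem_cat inE ks !orbT.
Qed.

Lemma utilitarian_ge sigma : \sum_i to_dest i <= utilitarian G sigma.
Proof. by apply: ler_sum => i _; apply: cost_ge. Qed.

(** If [j] is another bus, this is [cost_le] after the deviation of [i] to [j]; if [j] is the bus of
    [i], it is [cost_le] for [sigma] itself. Covering both cases allows averaging over all buses. *)
Lemma nash_cost_le sigma i j : nash G sigma ->
  cost G sigma i <= to_dest i + 2 * \sum_(k | sigma k == j) to_dest k.
Proof.
move=> nash_sigma.
pose sigma' : outcome n m := [ffun k => if k == i then j else sigma k].
have sigma'i : sigma' i = j by rewrite ffunE eqxx.
have sigma'k k : k != i -> sigma' k = sigma k by rewrite ffunE => /negPf->.
have le_sigma' : cost G sigma i <= cost G sigma' i.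
  have [eq_i|neq_i] := eqVneq (sigma' i) (sigma i); last exact: nash_sigma.
  suff -> : sigma' = sigma by [].
  by apply/ffunP => k; have [->|/sigma'k] := eqVneq k i.
apply: le_trans le_sigma' _; apply: le_trans (cost_le _ _) _.
rewrite lerD2l ler_pM2l// [leLHS]big_mkcond [leRHS]big_mkcond /=.
apply: ler_sum => k _; rewrite sigma'i.
have [_|/sigma'k->] := eqVneq k i; last by [].
by case: ifP; rewrite ?dist_ge0.
Qed.

Lemma nash_utilitarian_le sigma : nash G sigma ->
  m%:R * utilitarian G sigma <= (m + 2 * n)%:R * \sum_i to_dest i.
Proof.
move=> nash_sigma; set X := \sum_i to_dest i.
have cost_avg i : m%:R * cost G sigma i <= m%:R * to_dest i + 2 * X.
  (* The buses partition the players, so the bounds of [nash_cost_le] over all [j] add up to a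
     multiple of [X]. *)
  have -> : X = \sum_j \sum_(k | sigma k == j) to_dest k.
    by rewrite /X (partition_big sigma xpredT).
  have mulmE a : m%:R * a = \sum_(j < m) a.
    by rewrite sumr_const card_ord mulr_natl.
  rewrite !mulmE mulr_sumr -big_split /=.
  by apply: ler_sum => j _; apply: nash_cost_le.
rewrite mulr_sumr; apply: le_trans (ler_sum _ (fun i _ => cost_avg i)) _.
rewrite big_split /= -mulr_sumr -/X sumr_const card_ord natrD natrM.
by rewrite -(mulr_natl (2 * X)); lra.
Qed.

End Metric.

Lemma PoA_U_le (R : realType) n m : (0 < m <= n)%N ->
  (PoA_U R n m <= (3 * (n%:R / m%:R))%:E)%E.
Proof.
move=> /andP[m_gt0 le_mn]; apply: ge_ereal_sup => _ [G [metricG _ [o min_o o_gt0]] <-].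
apply: ge_ereal_sup => _ [sigma [opt [nash_sigma min_opt ->]]].
rewrite lee_fin; have opt_gt0 : 0 < utilitarian G opt.
  exact: lt_le_trans o_gt0 (min_o opt).
have m_gt0R : 0 < m%:R :> R by rewrite ltr0n.
rewrite ler_pdivrMr// -(ler_pM2l m_gt0R).
apply: le_trans (nash_utilitarian_le metricG nash_sigma) _.
have -> : m%:R * (3 * (n%:R / m%:R) * utilitarian G opt)
        = (3 * n)%:R * utilitarian G opt.
  by rewrite natrM; field; rewrite lt0r_neq0.
apply: ler_pM => //; first by apply: sumr_ge0 => i _; apply: dist_ge0.
(* The constant 3 comes from here: [m + 2 * n <= 3 * n] when [m <= n]. *)
- by rewrite ler_nat; lia.
- exact: utilitarian_ge.
Qed.

(** * Lower bound from a game on a line *)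

Section LineGame.
Context (R : realType) (n m : nat).

Definition height (x : vertex n) : R :=
  if x is Player i then (i < m)%:R else 0.

Definition line_dist (x y : vertex n) : R := `|height x - height y|.

Lemma line_dist_ge0 x y : 0 <= line_dist x y. Proof. exact: normr_ge0. Qed.

Lemma line_distC x y : line_dist x y = line_dist y x. Proof. exact: distrC. Qed.

Lemma line_distxx x : line_dist x x = 0.
Proof. by rewrite /line_dist subrr normr0. Qed.

(** The far players are those of index below [m]; visiting players by decreasing index puts them
    last on every bus. *)
Definition line_game : game R n m :=
  Game (fun=> perm (@rev_ord_inj n)) line_dist_ge0 line_distC line_distxx.

Lemma metric_line_game : metric line_game.
Proof. by move=> x y w; apply: ler_distD. Qed.

Lemma line_dist_dest i : dist line_game (Player i) Dest = (i < m)%:R.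
Proof. by rewrite /= /line_dist subr0 ger0_norm. Qed.

Lemma sum_line_dist_dest :
  \sum_i dist line_game (Player i) Dest = (minn n m)%:R.
Proof.
under eq_bigr do rewrite line_dist_dest.
rewrite -natr_sum; congr _%:R.
elim: n => [|k IHk]; first by rewrite big_ord0 min0n.
by rewrite big_ord_recr /= IHk; lia.
Qed.

Lemma route_line_game sigma j :
  pairwise (fun i k : 'I_n => (k < i)%N) (route line_game sigma j).
Proof.
rewrite pairwise_filter// pairwise_map.
have : pairwise (fun i k : 'I_n => (i < k)%N) (enum 'I_n).
  rewrite -(pairwise_map val ltn) val_enum_ord.
  by rewrite -sorted_pairwise ?iota_ltn_sorted//; apply: ltn_trans.
by apply: sub_pairwise => i k /=; rewrite !permE /=; have := ltn_ord k; lia.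
Qed.

(** The far player [k] is visited after [i], so [i] rides from height 0 up to height 1 and back. *)
Lemma cost_line_game_ge2 (sigma : outcome n m) (i k : 'I_n) : (k < m <= i)%N -> sigma k = sigma i ->
  2 <= cost line_game sigma i.
Proof.
move=> /andP[lt_km le_mi] eq_ki; have [r [s [rE ->]]] := cost_travel line_game sigma i.
have := route_line_game sigma (sigma i).
rewrite rE pairwise_cat => /andP[/allrelP lt_r _].
have : k \in r ++ i :: s by rewrite -rE mem_route eq_ki.
rewrite mem_cat inE => /or3P[k_r|/eqP eq_k|k_s].
- by have := lt_r k i k_r (mem_head _ _); lia.
- by move: lt_km; rewrite eq_k; lia.
apply: le_trans (travel_ge_via metric_line_game _ k_s).
rewrite line_dist_dest /= /line_dist /= lt_km (leq_gtF le_mi).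
by rewrite sub0r normrN normr1.
Qed.

Hypothesis m_gt1 : (1 < m)%N.
Let bus0 := Ordinal (ltnW m_gt1).
Let bus1 := Ordinal m_gt1.

(** With one bus per height, no bus changes height between its players, and each player pays only
    its distance to [Dest]. Two buses are needed. *)
Definition gathered : outcome n m :=
  [ffun i : 'I_n => if (i < m)%N then bus1 else bus0].

(** Far player [i] takes bus [i]; the default of [insubd] puts all near players on [bus0]. *)
Definition spread : outcome n m := [ffun i => insubd bus0 (val i)].

Lemma spread_val i : val (spread i) = if (i < m)%N then val i else 0%N.
Proof. by rewrite ffunE val_insubd. Qed.

Lemma cost_gathered i : cost line_game gathered i = (i < m)%:R.
Proof.
have [r [s [rE ->]]] := cost_travel line_game gathered i.
rewrite -line_dist_dest.
have : forall k, k \in s -> (k < m)%N = (i < m)%N.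
  move=> k k_s; have : k \in route line_game gathered (gathered i).
    by rewrite rE mem_cat inE k_s !orbT.
  by rewrite mem_route !ffunE; do 2?case: ifP.
elim: s i {r rE} => //= k s IHs i eq_s.
have eq_k := eq_s k (mem_head _ _).
rewrite IHs => [|l l_s]; last by rewrite eq_s ?inE ?l_s ?orbT.
by rewrite /= /line_dist /= eq_k subrr normr0 add0r.
Qed.

Lemma utilitarian_gathered : utilitarian line_game gathered = (minn n m)%:R.
Proof.
rewrite -sum_line_dist_dest; apply: eq_bigr => i _.
by rewrite cost_gathered line_dist_dest.
Qed.

Lemma minimizer_gathered : minimizer (utilitarian line_game) gathered.
Proof.
move=> sigma; rewrite utilitarian_gathered -sum_line_dist_dest.
exact: utilitarian_ge metric_line_game sigma.
Qed.

Lemma cost_spread_far (i : 'I_n) : (i < m)%N -> cost line_game spread i <= 1.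
Proof.
move=> lt_im; apply: le_trans (cost_le metric_line_game _ _) _.
rewrite line_dist_dest lt_im big1 ?mulr0 ?addr0// => k /andP[neq_ki].
rewrite line_dist_dest -val_eqE /= !spread_val lt_im.
by case: ifP => // _ /eqP/val_inj eq_ki; rewrite eq_ki eqxx in neq_ki.
Qed.

Lemma cost_spread_near (i : 'I_n) : (m <= i)%N -> cost line_game spread i <= 2.
Proof.
move=> le_mi; apply: le_trans (cost_le metric_line_game _ _) _.
(* Player 0 is the only far passenger of [bus0], so the sum in [cost_le] is at most 1. *)
pose i0 := Ordinal (leq_ltn_trans (leq0n i) (ltn_ord i)).
rewrite line_dist_dest (leq_gtF le_mi) add0r -[leRHS]mulr1 ler_pM2l//.
rewrite (bigD1 i0) /=; last first.
  by rewrite -!val_eqE /= !spread_val (leq_gtF le_mi) /=; case: ifP; lia.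
rewrite -[line_dist]/(dist line_game) line_dist_dest.
rewrite big1 ?addr0 ?lern1 ?leq_b1// => k /andP[/andP[_]].
rewrite line_dist_dest -!val_eqE /= !spread_val (leq_gtF le_mi).
by case: ifP => // _ ->.
Qed.

(** A near player exists only if [m < n]; then each bus [j] has far player [j], who stays put when
    [i] moves. *)
Lemma bus_has_far (sigma : outcome n m) (i : 'I_n) : (m <= i)%N ->
  (forall k, k != i -> sigma k = spread k) ->
  exists2 k : 'I_n, (k < m)%N & sigma k = sigma i.
Proof.
move=> le_mi eq_sigma; have lt_jm := ltn_ord (sigma i).
have lt_jn : (sigma i < n)%N by have := ltn_ord i; lia.
exists (Ordinal lt_jn) => //; rewrite eq_sigma; last first.
  by rewrite -val_eqE /=; lia.
by apply: val_inj; rewrite spread_val lt_jm.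
Qed.

Lemma nash_spread : nash line_game spread.
Proof.
move=> i sigma _ eq_sigma; have [lt_im|le_mi] := ltnP i m.
  apply: le_trans (cost_spread_far lt_im) _.
  by have := cost_ge metric_line_game sigma i; rewrite line_dist_dest lt_im.
apply: le_trans (cost_spread_near le_mi) _.
have [k lt_km eq_ki] := bus_has_far le_mi eq_sigma.
by apply: cost_line_game_ge2 eq_ki; rewrite lt_km.
Qed.

Lemma utilitarian_spread : (2 * n - minn n m)%:R <= utilitarian line_game spread.
Proof.
rewrite natrB; last lia.
(* Splits the bound into one term per player, 2 minus its distance to [Dest]: 1 if far, 2 if
   near. *)
rewrite -sum_line_dist_dest natrM mulr_natr -[X in _ *+ X]card_ord -sumr_const -sumrB.
apply: ler_sum => i _; rewrite line_dist_dest; case: ltnP => [lt_im|le_mi].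
  by have := cost_ge metric_line_game spread i; rewrite line_dist_dest lt_im mulr1n; lra.
have [//|k lt_km eq_ki] := @bus_has_far spread i le_mi.
by rewrite subr0; apply: cost_line_game_ge2 eq_ki; rewrite lt_km.
Qed.

Lemma PoA_U_ge : (0 < n)%N -> ((n%:R / m%:R)%:E <= PoA_U R n m)%E.
Proof.
move=> n_gt0; have F_gt0 : 0 < (minn n m)%:R :> R by rewrite ltr0n; lia.
apply: (@le_trans _ _ (PoA_game (utilitarian line_game) line_game)); last first.
  apply: ereal_sup_ubound; exists line_game => //; split.
  - exact: metric_line_game.
  - by exists spread; apply: nash_spread.
  - exists gathered; first exact: minimizer_gathered.
    by rewrite utilitarian_gathered.
apply: (@le_trans _ _
  (utilitarian line_game spread / utilitarian line_game gathered)%:E); last first.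
  apply: ereal_sup_ubound; exists spread, gathered; split=> //.
  - exact: nash_spread.
  - exact: minimizer_gathered.
rewrite lee_fin utilitarian_gathered ler_pdivlMr//.
apply: le_trans utilitarian_spread.
rewrite mulrAC ler_pdivrMr ?ltr0n ?(ltnW m_gt1)//.
(* For [n <= m] this is [n * n <= n * m]; otherwise it is [n * m <= (2 * n - m) * m]. *)
by rewrite -!natrM ler_nat; nia.
Qed.

End LineGame.

(* PoA_U >= 1 whenever n >= 1, so an upper bound of order n/m is impossible as
   n/m tends to 0; it is asserted for n >= m. *)
Theorem theorem4p3 (R : realType) :
  exists c C : R, [/\ 0 < c, 0 < C &
    forall n m : nat, (1 <= n)%N -> (2 <= m)%N ->
      ((c * (n%:R / m%:R))%:E <= PoA_U R n m)%E /\
      ((m <= n)%N -> (PoA_U R n m <= (C * (n%:R / m%:R))%:E)%E)].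
Proof.
exists 1, 3; split=> // n m n_gt0 m_gt1; split=> [|le_mn].
  by rewrite mul1r; apply: PoA_U_ge.
by apply: PoA_U_le; rewrite le_mn ltnW.
Qed.
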